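(* Let $(X,\tau,E)$ be a soft topological space over $X$ and let $(F,E)$ be a soft set over $X$. Then $\mathrm{bd}^s(F,E)=\Phi$ if and only if $(F,E)$ is both a soft semi-closed set and a soft semi-open set.
   Context: Let $X$ be a universe and $E$ a nonempty set of parameters. A soft set $(F,E)$ over $X$ is a mapping $F:E\to P(X)$, where $P(X)$ is the power set of $X$. Inclusion $(F,E)\subseteq(G,E)$, union and intersection of soft sets are taken parameterwise (e.g. $(F,E)\subseteq(G,E)$ iff $F(e)\subseteq G(e)$ for all $e\in E$). $\Phi$ is the soft set with value $\emptyset$ at every parameter and $\widetilde X$ the soft set with value $X$ at every parameter. The relative complement is $(F,E)'=(F',E)$, $F'(e)=X\setminus F(e)$. A soft topology on $X$ is a collection $\tau$ of soft sets $(F,E)$ over $X$ containing $\Phi$ and $\widetilde X$, closed under arbitrary unions and under intersections of two members; $(X,\tau,E)$ is then a soft topological space over $X$. Members of $\tau$ are soft open; $(F,E)$ is soft closed if $(F,E)'\in\tau$. The soft closure $\overline{(F,E)}$ is the intersection of all soft closed sets containing $(F,E)$. A soft set $(F,E)$ is soft semi-open if there is a soft open set $(G,E)$ with $(G,E)\subseteq(F,E)\subseteq\overline{(G,E)}$; it is soft semi-closed if $(F,E)'$ is soft semi-open. The soft semi-interior $\mathrm{int}^s(F,E)$ is the union of all soft semi-open sets contained in $(F,E)$; the soft semi-exterior is $\mathrm{ext}^s(F,E)=\mathrm{int}^s((F,E)')$; the soft semi-boundary is $\mathrm{bd}^s(F,E)=(\mathrm{int}^s(F,E)\cup \mathrm{ext}^s(F,E))'$.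 *)

(* Defs.v *)
From mathcomp Require Import all_boot.
From mathcomp Require Import boolp classical_sets.
Set Implicit Arguments.
Unset Strict Implicit.
Unset Printing Implicit Defensive.
Local Open Scope classical_set_scope.

Definition soft_set (X E : Type) := E -> set X.

Section SoftSets.
Context {X E : Type}.
Implicit Types (F G : soft_set X E) (C : set (soft_set X E)).

Definition soft_null : soft_set X E := fun _ => set0.
Definition soft_absolute : soft_set X E := fun _ => setT.
Definition soft_sub F G : Prop := forall e, F e `<=` G e.
Definition soft_union F G : soft_set X E := fun e => F e `|` G e.
Definition soft_inter F G : soft_set X E := fun e => F e `&` G e.
Definition soft_compl F : soft_set X E := fun e => ~` F e.
Definition soft_bigcup C : soft_set X E := fun e => \bigcup_(F in C) F e.
Definition soft_bigcap C : soft_set X E := fun e => \bigcap_(F in C) F e.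

End SoftSets.

Record soft_topology (X E : Type) := SoftTopology {
  soft_open : set (soft_set X E);
  soft_open_null : soft_open soft_null;
  soft_open_absolute : soft_open soft_absolute;
  soft_open_bigcup : forall C : set (soft_set X E),
    C `<=` soft_open -> soft_open (soft_bigcup C);
  soft_open_inter : forall F G : soft_set X E,
    soft_open F -> soft_open G -> soft_open (soft_inter F G)
}.

Section SoftTopologicalNotions.
Context {X E : Type} (tau : soft_topology X E).
Implicit Types F G : soft_set X E.

Definition soft_closed F : Prop := soft_open tau (soft_compl F).

Definition soft_closure F : soft_set X E :=
  soft_bigcap [set G | soft_closed G /\ soft_sub F G].

Definition soft_semi_open F : Prop :=
  exists G, [/\ soft_open tau G, soft_sub G F & soft_sub F (soft_closure G)].

Definition soft_semi_closed F : Prop := soft_semi_open (soft_compl F).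

Definition soft_semi_interior F : soft_set X E :=
  soft_bigcup [set G | soft_semi_open G /\ soft_sub G F].

Definition soft_semi_exterior F : soft_set X E :=
  soft_semi_interior (soft_compl F).

Definition soft_semi_boundary F : soft_set X E :=
  soft_compl (soft_union (soft_semi_interior F) (soft_semi_exterior F)).

End SoftTopologicalNotions.

(* Main.v *)
Require Import Defs.
From mathcomp Require Import all_boot.
From mathcomp Require Import boolp classical_sets.

(** The soft semi-interior of [F] lies in [F] and the soft semi-exterior lies
    in the complement of [F].  An empty semi-boundary says that these two
    disjoint soft sets cover everything, which forces each to fill its half:
    the semi-interior equals [F] and the semi-exterior equals the complement of
    [F].  Soft semi-open sets are stable under arbitrary unions
    ([soft_semi_open_bigcup]), so a soft set is soft semi-open exactly when it
    equals its semi-interior ([soft_semi_openP]); applied to [F] and to its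
    complement this gives both directions. *)

Lemma soft_sub_trans {X E : Type} (F G H : soft_set X E) :
  soft_sub F G -> soft_sub G H -> soft_sub F H.
Proof. by move=> FG GH e x /FG /GH. Qed.

Lemma soft_sub_antisym {X E : Type} (F G : soft_set X E) :
  soft_sub F G -> soft_sub G F -> F = G.
Proof. by move=> FG GF; apply/funext => e; apply/seteqP; split. Qed.

Lemma soft_sub_bigcup {X E : Type} (C : set (soft_set X E)) (F : soft_set X E) :
  C F -> soft_sub F (soft_bigcup C).
Proof. by move=> CF e x Fx; exists F. Qed.

Lemma soft_bigcup_sub {X E : Type} (C : set (soft_set X E)) (G : soft_set X E) :
  (forall F, C F -> soft_sub F G) -> soft_sub (soft_bigcup C) G.
Proof. by move=> CG e x [F CF Fx]; apply: (CG F CF e x). Qed.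

Lemma soft_complK {X E : Type} (F : soft_set X E) :
  soft_compl (soft_compl F) = F.
Proof. by apply/funext => e; exact: setCK. Qed.

Lemma soft_compl_absolute {X E : Type} :
  soft_compl (@soft_absolute X E) = soft_null.
Proof. by apply/funext => e; exact: setCT. Qed.

Lemma soft_union_compl {X E : Type} (F : soft_set X E) :
  soft_union F (soft_compl F) = soft_absolute.
Proof. by apply/funext => e; exact: setUv. Qed.

(** A point of [F] is covered by [A] or by [B], and [B] misses [F]. *)
Lemma soft_union_absolute_sub {X E : Type} (F A B : soft_set X E) :
  soft_sub B (soft_compl F) -> soft_union A B = soft_absolute -> soft_sub F A.
Proof.
move=> BF AB e x Fx.
have : soft_union A B e x by rewrite AB.
by case=> // /BF.
Qed.

Lemma soft_unionC {X E : Type} (F G : soft_set X E) :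
  soft_union F G = soft_union G F.
Proof. by apply/funext => e; exact: setUC. Qed.

Section SemiOpen.
Context {X E : Type} (tau : soft_topology X E).
Implicit Types (F G : soft_set X E) (C : set (soft_set X E)).

Lemma soft_closure_mono F G :
  soft_sub F G -> soft_sub (soft_closure tau F) (soft_closure tau G).
Proof.
move=> FG e x clFx H [Hcl GH]; apply: clFx; split=> //.
exact: soft_sub_trans FG GH.
Qed.

(** The union of the open witnesses of the members is an open witness for the
    union, because closure is monotone. *)
Lemma soft_semi_open_bigcup C :
  (forall F, C F -> soft_semi_open tau F) ->
  soft_semi_open tau (soft_bigcup C).
Proof.
move=> Cso.
(* Collecting every witness of every member avoids choosing one for each. *)
pose W : set (soft_set X E) := fun G => exists F,
  [/\ C F, soft_open tau G, soft_sub G F & soft_sub F (soft_closure tau G)].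
exists (soft_bigcup W); split.
- by apply: soft_open_bigcup => G [F []].
- apply: soft_bigcup_sub => G [F [CF _ GF _]].
  exact: soft_sub_trans GF (soft_sub_bigcup C F CF).
- apply: soft_bigcup_sub => F CF.
  have [G [Go GF FclG]] := Cso F CF.
  apply: (soft_sub_trans _ _ _ FclG); apply: soft_closure_mono.
  by apply: soft_sub_bigcup; exists F.
Qed.

Lemma soft_semi_interior_sub F : soft_sub (soft_semi_interior tau F) F.
Proof. by apply: soft_bigcup_sub => G []. Qed.

Lemma soft_semi_openP F :
  soft_semi_open tau F <-> soft_semi_interior tau F = F.
Proof.
split=> [Fso|<-]; last by apply: soft_semi_open_bigcup => G [].
apply: soft_sub_antisym; first exact: soft_semi_interior_sub.
by apply: soft_sub_bigcup; split=> // e x.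
Qed.

Lemma soft_semi_boundary_nullP F :
  soft_semi_boundary tau F = soft_null <->
  soft_union (soft_semi_interior tau F) (soft_semi_exterior tau F)
    = soft_absolute.
Proof.
rewrite /soft_semi_boundary -soft_compl_absolute; split=> [bd0|-> //].
by rewrite -[LHS]soft_complK bd0 soft_complK.
Qed.

End SemiOpen.

Theorem theorem3p20 (X E : Type) (hE : inhabited E)
    (tau : soft_topology X E) (F : soft_set X E) :
  soft_semi_boundary tau F = soft_null <->
  soft_semi_closed tau F /\ soft_semi_open tau F.
Proof.
rewrite soft_semi_boundary_nullP /soft_semi_closed !soft_semi_openP.
rewrite /soft_semi_exterior.
split=> [cover|[-> ->]]; last exact: soft_union_compl.
split; apply: soft_sub_antisym; try exact: soft_semi_interior_sub.
- apply: soft_union_absolute_sub; last by rewrite soft_unionC; exact: cover.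
  by rewrite soft_complK; exact: soft_semi_interior_sub.
- apply: soft_union_absolute_sub cover; exact: soft_semi_interior_sub.
Qed.
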